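(* Let $\mu$ be a nonzero finite Borel measure on $\mathbb{R}^d$ and $\mathcal{E}=\mathcal{E}_\mu$ the exponential family based on $\mu$. The extension $\operatorname{ext}(\mathcal{E})$ is variation-closed, i.e. if a sequence in $\operatorname{ext}(\mathcal{E})$ converges in variation distance to a probability measure $P$, then $P\in\operatorname{ext}(\mathcal{E})$.
   Context: For nonempty $B\subseteq\mathbb{R}^d$, $\operatorname{lin}(B)$ is the linear subspace obtained by shifting the affine hull of $B$ to contain the origin; $\operatorname{cl}$ is closure. A face of a nonempty convex set $C$ is a nonempty convex subset $F\subseteq C$ such that $tx+(1-t)y\in F$ with $x,y\in C$, $0<t<1$ implies $x,y\in F$ ($F=C$ allowed). The convex support $\operatorname{cs}(\mu)$, resp. convex core $\operatorname{cc}(\mu)$, is the intersection of all closed convex sets, resp. all convex Borel sets, $C\subseteq\mathbb{R}^d$ with $\mu(C)=\mu(\mathbb{R}^d)$; $\operatorname{lin}(\mu)=\operatorname{lin}(\operatorname{cs}(\mu))$. $\mathcal{E}=\mathcal{E}_\mu=\{Q_\vartheta:\vartheta\in\operatorname{dom}(\Lambda)\cap\operatorname{lin}(\mu)\}$, where $\Lambda(\vartheta)=\ln\int_{\mathbb{R}^d}e^{\langle\vartheta,x\rangle}\mu(dx)$, $\operatorname{dom}(\Lambda)=\{\Lambda<\infty\}$, and $Q_\vartheta$ is the probability measure with $\mu$-density $e^{\langle\vartheta,x\rangle-\Lambda(\vartheta)}$. For a face $F$ of $\operatorname{cc}(\mu)$ (for which $\mu(\operatorname{cl}(F))>0$), $\mathcal{E}^F$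 is the exponential family based on the restriction of $\mu$ to $\operatorname{cl}(F)$: $\mathcal{E}^F=\{Q_{F,\theta}:\theta\in\Theta_F\}$, where $\Lambda_F(\vartheta)=\ln\int_{\operatorname{cl}(F)}e^{\langle\vartheta,x\rangle}\mu(dx)$, $\Theta_F=\{\Lambda_F<\infty\}\cap\operatorname{lin}(F)$ and $Q_{F,\theta}$ has density $e^{\langle\theta,x\rangle-\Lambda_F(\theta)}$ with respect to the restriction of $\mu$ to $\operatorname{cl}(F)$. The extension $\operatorname{ext}(\mathcal{E})$ is the union of the families $\mathcal{E}^F$ over all faces $F$ of $\operatorname{cc}(\mu)$. Convergence in variation distance means that the total variation of the difference goes to zero. *)

(* Defs.v *)
(* MathComp-Analysis, over an arbitrary R : realType; R^d is 'rV[R]_d. *)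
From HB Require Import structures.
From mathcomp Require Import all_boot all_order all_algebra.
From mathcomp Require Import all_classical all_reals all_analysis.

Set Implicit Arguments.
Unset Strict Implicit.
Unset Printing Implicit Defensive.

Import Order.TTheory GRing.Theory Num.Theory.
Import numFieldNormedType.Exports.

Local Open Scope classical_set_scope.
Local Open Scope ring_scope.

(* Borel sigma-algebra; matrices come with no measurable structure. *)
HB.instance Definition _ (R : realType) (m n : nat) :=
  @isMeasurable.Build (sigma_display (@open 'M[R]_(m, n))) 'M[R]_(m, n)
    <<s (@open 'M[R]_(m, n)) >>
    (@sigma_algebra0 _ setT (@open 'M[R]_(m, n)))
    (@sigma_algebraC _ (@open 'M[R]_(m, n)))
    (@sigma_algebra_bigcup _ setT (@open 'M[R]_(m, n))).

Lemma closed_measurable_mx (R : realType) (m n : nat) (A : set 'M[R]_(m, n)) :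
  closed A -> measurable A.
Proof.
move=> cA; rewrite -[A]setCK; apply: measurableC.
by apply: sub_gen_smallest; exact: closed_openC.
Qed.

Section convex_geometry.
Context {R : realType} {d : nat}.
Implicit Types A B C F : set 'rV[R]_d.

Definition dotv (u v : 'rV[R]_d) : R := \sum_(i < d) u ord0 i * v ord0 i.

Definition affine_set A : Prop :=
  forall (x y : 'rV[R]_d) (t : R), A x -> A y -> A (t *: x + (1 - t) *: y).

Definition affine_hull B : set 'rV[R]_d := smallest affine_set B.

(* For nonempty B all the shifts of affine_hull B that contain 0 coincide. *)
Definition lin B : set 'rV[R]_d :=
  [set v | exists2 b, affine_hull B b & affine_hull B (b + v)].

Definition is_convex C : Prop := @convex_set R 'rV[R]_d C.

Definition face C F : Prop :=
  [/\ F !=set0, is_convex F, F `<=` C &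
    forall (x y : 'rV[R]_d) (t : R), C x -> C y -> 0 < t -> t < 1 ->
      F (t *: x + (1 - t) *: y) -> F x /\ F y].

End convex_geometry.

Section measures.
Context {R : realType} {d : nat}.
Local Open Scope ereal_scope.

Definition convex_support (mu : {measure set 'rV[R]_d -> \bar R}) :=
  \bigcap_(C in [set C | [/\ closed C, is_convex C & mu C = mu setT]]) C.

Definition convex_core (mu : {measure set 'rV[R]_d -> \bar R}) :=
  \bigcap_(C in [set C | [/\ measurable C, is_convex C & mu C = mu setT]]) C.

Definition log_laplace (nu : {measure set 'rV[R]_d -> \bar R})
    (theta : 'rV[R]_d) : \bar R :=
  lne (\int[nu]_x (expR (dotv theta x))%:E).

Definition tilt (nu : {measure set 'rV[R]_d -> \bar R}) (theta : 'rV[R]_d)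
    (A : set 'rV[R]_d) : \bar R :=
  \int[nu]_(x in A) (expR (dotv theta x - fine (log_laplace nu theta)))%:E.

(* Equality of measures is equality on measurable sets. *)
Definition tilt_family (nu : {measure set 'rV[R]_d -> \bar R})
    (L : set 'rV[R]_d) : set (probability 'rV[R]_d R) :=
  [set P | exists theta, [/\ log_laplace nu theta < +oo, L theta &
    forall A, measurable A -> P A = tilt nu theta A]].

Definition exp_family (mu : {measure set 'rV[R]_d -> \bar R}) :=
  tilt_family mu (lin (convex_support mu)).

Definition restr_closure (mu : {measure set 'rV[R]_d -> \bar R})
    (F : set 'rV[R]_d) : {measure set 'rV[R]_d -> \bar R} :=
  mrestr mu (closed_measurable_mx (@closed_closure _ F)).

Definition face_family (mu : {measure set 'rV[R]_d -> \bar R})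
    (F : set 'rV[R]_d) :=
  tilt_family (restr_closure mu F) (lin F).

(* Contains exp_family mu, as the family of the face convex_core mu. Families
   with mu (closure F) = 0 (there are none when F is a face of convex_core mu
   and mu != 0) would be empty, tilt then being the zero measure. *)
Definition extension (mu : {measure set 'rV[R]_d -> \bar R}) :=
  \bigcup_(F in face (convex_core mu)) face_family mu F.

End measures.

Section variation.
Context d (T : measurableType d) (R : realType).
Local Open Scope ereal_scope.

(* charge_variation does not depend on the chosen Hahn decomposition. *)
Definition charge_total_variation (nu : {charge set T -> \bar R}) : \bar R :=
  charge_variation
    (projT2 (cid (projT2 (cid (Hahn_decomposition nu))))) setT.

Definition variation_distance (P Q : probability T R) : \bar R :=
  charge_total_variation
    (cadd (charge_of_finite_measure P) (copp (charge_of_finite_measure Q))).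

Definition variation_closed (S : set (probability T R)) : Prop :=
  forall (P_ : nat -> probability T R) (P : probability T R),
    (forall n, S (P_ n)) ->
    (fun n => variation_distance (P_ n) P) @ \oo --> 0 ->
    S P.

End variation.

(* Main.v *)
Require Import Defs.
From HB Require Import structures.
From mathcomp Require Import all_boot all_order all_algebra.
From mathcomp Require Import all_classical all_reals all_analysis.
From mathcomp Require Import measurable_realfun ring lra.

Import Order.TTheory GRing.Theory Num.Theory.
Import numFieldNormedType.Exports.

Local Open Scope classical_set_scope.
Local Open Scope ring_scope.

(* Let K be the convex core of mu.  Call flat an affine set A that is extreme in
   some convex Borel set of full measure.  Since mu restricted to A is carried
   by the closure of the part of K in A, and since a proper face of a convex set
   lies in a supporting hyperplane, the faces F of K are, up to null sets, the
   traces on K of the flats: cl F is contained in A and mu (A \ cl F) = 0.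
   Hence ext(E) consists of the probability measures with a mu-density of the
   form 1_A(x) exp(<th, x> - c), A flat.  Let such densities f_n, with flats A_n
   and parameters th_n, converge in variation; along a subsequence f_n -> f
   almost everywhere.  The points that belong to all but finitely many A_n form
   a flat off which f vanishes.  Restrict to such a flat A and drop from th_n
   the component orthogonal to the directions of A.  Along an ultrafilter, the
   remaining components either are bounded, hence converge, and f is exponential
   on A; or they are unbounded, their directions converge to some u, and f
   vanishes off the face of A where <u, x> is maximal, which is again cut out by
   a flat, of smaller dimension. *)

(** * Separation in finite dimension *)

Section dot_product.
Context {R : realType} {d : nat}.
Implicit Types u v w : 'rV[R]_d.

Lemma dotv_mulmx u v : dotv u v = (u *m v^T) ord0 ord0.
Proof. by rewrite /dotv mxE; apply: eq_bigr => i _; rewrite mxE. Qed.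

Lemma dotvC u v : dotv u v = dotv v u.
Proof. by apply: eq_bigr => i _; rewrite mulrC. Qed.

Lemma dotvDr u v w : dotv u (v + w) = dotv u v + dotv u w.
Proof. by rewrite -big_split; apply: eq_bigr => i _ /=; rewrite mxE mulrDr. Qed.

Lemma dotvZr u a v : dotv u (a *: v) = a * dotv u v.
Proof. by rewrite mulr_sumr; apply: eq_bigr => i _; rewrite mxE mulrCA. Qed.

Lemma dotvNr u v : dotv u (- v) = - dotv u v.
Proof. by rewrite -scaleN1r dotvZr mulN1r. Qed.

Lemma dotvBr u v w : dotv u (v - w) = dotv u v - dotv u w.
Proof. by rewrite dotvDr dotvNr. Qed.

Lemma dotvDl u v w : dotv (u + v) w = dotv u w + dotv v w.
Proof. by rewrite dotvC dotvDr !(dotvC w). Qed.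

Lemma dotvZl a u v : dotv (a *: u) v = a * dotv u v.
Proof. by rewrite dotvC dotvZr dotvC. Qed.

Lemma dotvBl u v w : dotv (u - v) w = dotv u w - dotv v w.
Proof. by rewrite dotvC dotvBr !(dotvC w). Qed.

Lemma dotv0r u : dotv u 0 = 0.
Proof. by rewrite -(scale0r 0) dotvZr mul0r. Qed.

Lemma dotvv_ge0 u : 0 <= dotv u u.
Proof. by apply: sumr_ge0 => i _; rewrite -expr2 sqr_ge0. Qed.

Lemma dotvv_eq0 u : (dotv u u == 0) = (u == 0).
Proof.
apply/eqP/eqP => [|->]; last by rewrite dotv0r.
move/eqP; rewrite psumr_eq0 => [/allP u0|i _]; last by rewrite -expr2 sqr_ge0.
apply/rowP => i; rewrite mxE; apply/eqP.
by have := u0 i (mem_index_enum _); rewrite mulf_eq0 orbb.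
Qed.

Lemma dotv_submx_eq0 k (M : 'M[R]_(k, d)) u v :
  M *m u^T = 0 -> (v <= M)%MS -> dotv u v = 0.
Proof.
move=> Mu /submxP[c ->].
by rewrite dotvC dotv_mulmx -mulmxA Mu mulmx0 mxE.
Qed.

(** A row lies in the row space of [M] exactly when [cokermx M] kills it, so some column of
    [cokermx M] pairs nontrivially with [v]; rescaled, that column is [u]. *)
Lemma notin_submx_dotv k (M : 'M[R]_(k, d)) v :
  ~~ (v <= M)%MS -> exists u, M *m u^T = 0 /\ dotv u v = 1.
Proof.
rewrite submxE => /matrix0Pn[i [j]]; rewrite (ord1 i) => vj.
have Mc : M *m col j (cokermx M) = 0.
  by rewrite colE mulmxA mulmx_coker mul0mx.
exists (((v *m cokermx M) ord0 j)^-1 *: (col j (cokermx M))^T); split.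
  by rewrite linearZ /= trmxK -scalemxAr Mc scaler0.
rewrite dotvZl dotvC dotv_mulmx trmxK.
have -> : (v *m col j (cokermx M)) ord0 ord0 = (v *m cokermx M) ord0 j.
  by rewrite colE mulmxA -colE mxE.
by rewrite mulVf.
Qed.

(** Orthogonal projection. If [u] were outside the sum of the row space and its orthogonal
    complement, a functional separating it from that sum would be orthogonal to both, hence
    orthogonal to itself. *)
Lemma submx_orth_decomp k (M : 'M[R]_(k, d)) u :
  exists v, (v <= M)%MS /\ M *m (u - v)^T = 0.
Proof.
have [/submxP[D uD]|] :=
    boolP (u <= M + kermx M^T)%MS; last first.
  move=> /notin_submx_dotv[w [Hw uw]]; exfalso.
  have wM : (w <= kermx M^T)%MS.
    have : (M *m w^T)^T = 0^T.
      have /submxP[E ->] : (M <= M + kermx M^T)%MS by exact: addsmxSl.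
      by rewrite -mulmxA Hw mulmx0.
    by rewrite trmx_mul trmxK trmx0 => /eqP wM; rewrite sub_kermx.
  have /eqP : dotv w w = 0.
    by apply: (dotv_submx_eq0 _ _ _ _ Hw); apply: submx_trans (addsmxSr _ _).
  rewrite dotvv_eq0 => /eqP w0.
  by move: uw; rewrite w0 dotvC dotv0r => /eqP; rewrite eq_sym oner_eq0.
have /sub_addsmxP[[a b] /= uab] : (u <= M + kermx M^T)%MS.
  by rewrite uD submxMl.
exists (a *m M); split; first exact: submxMl.
rewrite uab addrC addKr trmx_mul mulmxA.
have -> : M *m (kermx M^T)^T = 0.
  by apply: trmx_inj; rewrite trmx_mul trmxK mulmx_ker trmx0.
by rewrite mul0mx.
Qed.

(** The codimension [d - \rank M] is the measure of all the inductions on dimension below. *)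
Lemma rank_adds_row k (M : 'M[R]_(k, d)) u n : ~~ (u <= M)%MS ->
  (d - \rank M <= n.+1)%N -> (d - \rank (M + u)%MS <= n)%N.
Proof.
move=> uM; rewrite !leq_subLR addnS -addSn => /leq_trans; apply.
rewrite leq_add2r; have : (M < M + u)%MS.
  by rewrite /ltmx addsmxSl /= addsmx_sub negb_and uM orbT.
by rewrite ltmxErank => /andP[].
Qed.

Lemma full_rank_submx k (M : 'M[R]_(k, d)) u : (d - \rank M <= 0)%N ->
  (u <= M)%MS.
Proof.
rewrite leqn0 subn_eq0 => dM; apply: submx_full.
by rewrite /row_full eqn_leq rank_leq_col.
Qed.

(** Invariant of the inductions on flats: the row space of [M] consists of functionals constant on
    [A], and cutting [A] by a hyperplane adds the normal of that hyperplane. *)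
Lemma constant_adds_row k (M : 'M[R]_(k, d)) u (a : R) (A : set 'rV[R]_d) :
  (forall x y g, A x -> A y -> (g <= M)%MS -> dotv g x = dotv g y) ->
  forall x y g, (A `&` [set x | dotv u x = a]) x ->
    (A `&` [set x | dotv u x = a]) y -> (g <= M + u)%MS -> dotv g x = dotv g y.
Proof.
move=> AM x y g [Ax /= ux] [Ay /= uy] /sub_addsmxP[[b c] /= ->].
rewrite !dotvDl (AM x y _ Ax Ay (submxMl _ _)) (mx11_scalar c) mul_scalar_mx.
by rewrite !dotvZl ux uy.
Qed.

(** A finite family in [S] of maximal rank works: an element of [S] outside its span would raise the
    rank. *)
Lemma spanning_rows (S : set 'rV[R]_d) :
  exists k (M : 'M[R]_(k, d)), (forall i, S (row i M)) /\
    (forall y, S y -> (y <= M)%MS).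
Proof.
pose P r := `[< exists k (M : 'M[R]_(k, d)),
  (forall i, S (row i M)) /\ \rank M = r >].
have P0 : exists r, P r.
  by exists 0%N; apply/asboolP; exists 0%N, 0; split; [case|rewrite mxrank0].
have Pd r : P r -> (r <= d)%N.
  by move=> /asboolP[k [M [_ <-]]]; exact: rank_leq_col.
case: (ex_maxnP P0 Pd) => r /asboolP[k [M [SM rM]]] rmax.
exists k, M; split => // y Sy; apply: contrapT => yM.
have : P (\rank (col_mx M y)).
  apply/asboolP; exists (k + 1)%N, (col_mx M y); split => // i.
  case: (splitP i) => j ij.
    have -> : i = lshift 1 j by exact: val_inj.
    by rewrite rowKu.
  have -> : i = rshift k j by exact: val_inj.
  by rewrite rowKd row_id.
move/rmax; apply/negP; rewrite -ltnNge -rM -addsmxE.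
have : (M < M + y)%MS.
  rewrite /ltmx addsmxSl /= addsmx_sub negb_and.
  by apply/orP; right; apply/negP.
by rewrite ltmxErank => /andP[].
Qed.

End dot_product.

(** * Convex sets, their relative cores and supporting hyperplanes *)

Section convexity.
Context {R : realType} {d : nat}.
Implicit Types (u v w x y z : 'rV[R]_d) (K F C : set 'rV[R]_d).

Lemma is_convexP K : is_convex K <->
  forall x y (t : R), K x -> K y -> 0 <= t -> t <= 1 ->
    K (t *: x + (1 - t) *: y).
Proof.
split=> [cK x y t Kx Ky t0 t1|cK x y l /set_mem Kx /set_mem Ky].
  have t01 : (0 : R) <= t <= 1 by rewrite t0.
  have := cK x y (Itv01 t0 t1).
  by rewrite !inE => /(_ Kx Ky).
apply/mem_set; have := cK x y l%:num Kx Ky.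
by apply; [exact: ge0|exact: le1].
Qed.

Lemma is_convexI K C : is_convex K -> is_convex C -> is_convex (K `&` C).
Proof.
move=> /is_convexP cK /is_convexP cC; apply/is_convexP => x y t [Kx Cx] [Ky Cy].
by move=> t0 t1; split; [exact: cK|exact: cC].
Qed.

Lemma is_convex_bigcap (G : set (set 'rV[R]_d)) :
  (forall C, G C -> is_convex C) -> is_convex (\bigcap_(C in G) C).
Proof.
move=> cG; apply/is_convexP => x y t Kx Ky t0 t1 C GC.
by move/is_convexP: (cG _ GC); apply => //; [exact: Kx|exact: Ky].
Qed.

Lemma affine_convex K : affine_set K -> is_convex K.
Proof. by move=> aK; apply/is_convexP => x y t Kx Ky _ _; exact: aK. Qed.

Lemma convex_halfspace u (a : R) : is_convex [set x | dotv u x <= a].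
Proof.
apply/is_convexP => x y t /= ux uy t0 t1.
by rewrite dotvDr !dotvZr; nra.
Qed.

(** The missing weight [1 - \sum_i c i] is carried by [x0]. The induction splits off the last term
    and renormalizes the others. *)
Lemma convex_sum K x0 n (c : 'I_n -> R) (f : 'I_n -> 'rV[R]_d) :
  is_convex K -> K x0 -> (forall i, K (x0 + f i)) -> (forall i, 0 <= c i) ->
  \sum_i c i <= 1 -> K (x0 + \sum_i c i *: f i).
Proof.
move=> /is_convexP cK Kx0; elim: n c f => [|n IH] c f Kf c0 c1.
  by rewrite big_ord0 addr0.
rewrite big_ord_recr /=; set t := c ord_max.
move: c1; rewrite big_ord_recr /= -/t => c1.
have t0 : 0 <= t by exact: c0.
set s := \sum_(i < n) c (widen_ord (leqnSn n) i) in c1.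
have s0 : 0 <= s by apply: sumr_ge0 => i _; exact: c0.
have [s00|sneq0] := eqVneq s 0.
  rewrite big1 ?add0r; last first.
    move=> i _; have /eqP := s00; rewrite psumr_eq0 => [/allP/(_ i)|j _].
      by rewrite mem_index_enum => /(_ isT)/eqP ->; rewrite scale0r.
    exact: c0.
  have -> : x0 + t *: f ord_max = t *: (x0 + f ord_max) + (1 - t) *: x0.
    by apply/rowP => i; rewrite !mxE; ring.
  apply: cK => //; move: c1; rewrite s00 add0r //.
have sgt0 : 0 < s by rewrite lt_neqAle eq_sym sneq0.
have st : s <= 1 - t by rewrite lerBrDr.
have t1 : 0 < 1 - t by exact: lt_le_trans st.
have Ky : K (x0 + \sum_(i < n) (c (widen_ord (leqnSn n) i) / (1 - t)) *:
              f (widen_ord (leqnSn n) i)).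
  apply: IH => // [i|]; first by rewrite divr_ge0 ?c0 // ltW.
  by rewrite -mulr_suml ler_pdivrMr ?mul1r.
have tneq : 1 - t != 0 by rewrite gt_eqF.
set S := \sum_(i < n) _ in Ky.
have -> : \sum_(i < n) c (widen_ord (leqnSn n) i) *: f (widen_ord (leqnSn n) i)
   = (1 - t) *: S.
  rewrite scaler_sumr; apply: eq_bigr => i _.
  by rewrite scalerA mulrC divfK.
have -> : x0 + ((1 - t) *: S + t *: f ord_max) =
   t *: (x0 + f ord_max) + (1 - t) *: (x0 + S).
  by apply/rowP => i; rewrite !mxE; ring.
by apply: cK => //; rewrite -subr_ge0 ltW.
Qed.

(** The relative interior in algebraic form: a segment of [K] that ends at [z] can be prolonged
    beyond [z] inside [K]. *)
Definition rel_core K : set 'rV[R]_d :=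
  [set z | K z /\ forall y, K y -> exists2 e, 0 < e & K (z + e *: (z - y))].

(** The barycentre of [x0] and the points [x0 + row i M], for directions spanning [K - x0], has only
    positive weights, which survive a small perturbation. *)
Lemma rel_core_nonempty K : is_convex K -> K !=set0 -> rel_core K !=set0.
Proof.
move=> cK [x0 Kx0].
have [k [M [KM spanM]]] := spanning_rows [set v | K (x0 + v)].
have k0 : (0 : R) < k.+1%:R by rewrite ltr0n.
have kE : k.+1%:R = k%:R + 1 :> R by rewrite -natr1.
have kn : (0 : R) <= k%:R by rewrite ler0n.
exists (x0 + \sum_(i < k) k.+1%:R^-1 *: row i M); split.
  apply: convex_sum => //.
  by rewrite sumr_const card_ord -[leLHS]mulr_natl ler_pdivrMr // kE; lra.
move=> y Ky.
have /submxP[b yb] : (y - x0 <= M)%MS.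
  by apply: spanM; rewrite /= addrC subrK.
rewrite mulmx_sum_row in yb.
set B := \sum_i `|b ord0 i|.
have B0 : 0 <= B by apply: sumr_ge0.
have Bi i : b ord0 i <= B.
  apply: le_trans (ler_norm _) _; rewrite /B (bigD1 i) //= lerDl.
  exact: sumr_ge0.
have B1 : - \sum_i b ord0 i <= B.
  by rewrite -sumrN; apply: ler_sum => i _; rewrite -normrN ler_norm.
(* With this [e] the barycentric weight [q] equals [e * (B + 1)]. The perturbed weights
   [(1 + e) * q - e * b ord0 i] are then nonnegative, and their sum is at most [1 - e * q]. *)
pose e := (k.+1%:R * (B + 1))^-1.
have e0 : 0 < e by rewrite invr_gt0 mulr_gt0 //; lra.
have eE : e * (k.+1%:R * (B + 1)) = 1 by rewrite mulVf // gt_eqF // -invr_gt0.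
set q := k.+1%:R^-1.
have qE : q = e * (B + 1).
  by rewrite /q /e invfM mulrVK // unitfE; apply/eqP; lra.
exists e => //.
have -> : y = x0 + \sum_i b ord0 i *: row i M by rewrite -yb addrC subrK.
set S := \sum_(i < k) _; set Y := \sum_(i < k) _.
have -> : x0 + S + e *: (x0 + S - (x0 + Y)) =
    x0 + \sum_(i < k) ((1 + e) * q - e * b ord0 i) *: row i M.
  have -> : \sum_(i < k) ((1 + e) * q - e * b ord0 i) *: row i M
     = (1 + e) *: S - e *: Y.
    rewrite /S /Y !scaler_sumr -sumrB; apply: eq_bigr => i _.
    by rewrite !scalerA scalerBl.
  by apply/rowP => i; rewrite !mxE; ring.
have q0 : 0 < q by rewrite invr_gt0.
have qk : q * k%:R + q = 1.
  by rewrite /q -{2}[k.+1%:R^-1]mulr1 -mulrDr -kE mulVf // gt_eqF.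
apply: convex_sum => // [i|].
  by rewrite subr_ge0 qE; have := Bi i; nra.
rewrite sumrB sumr_const card_ord -mulr_sumr -[X in X - _]mulr_natr.
by set Z := \sum_(i < k) _ in B1 *; nra.
Qed.

(** Prolong the segment from [x] to [z] up to [z + a *: (z - x)]. The ray from [x] through the given
    point meets the segment from there to [y] beyond that point, which gives the length of the
    prolongation. *)
Lemma rel_core_segment K z y (s : R) : is_convex K ->
  rel_core K z -> K y -> 0 < s -> s <= 1 -> rel_core K (s *: z + (1 - s) *: y).
Proof.
move=> /is_convexP cK [Kz zK] Ky s0 s1; split; first by apply: cK => //; lra.
move=> x Kx; have [a a0 Kz'] := zK x Kx.
have D0 : 0 < 1 + a - s * a by nra.
exists (s * a / (1 + a - s * a)); first by rewrite divr_gt0 // mulr_gt0.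
pose al := s / (1 + a - s * a).
have -> : s *: z + (1 - s) *: y + (s * a / (1 + a - s * a)) *:
   (s *: z + (1 - s) *: y - x) = al *: (z + a *: (z - x)) + (1 - al) *: y.
  by apply/rowP => i; rewrite !mxE /al; field; apply/eqP; lra.
apply: cK => //; first by rewrite divr_ge0 //; lra.
by rewrite ler_pdivrMr // mul1r; nra.
Qed.

(* M. Riesz' extension theorem: a functional that is nonnegative on the cone T
   inside the subspace V is extended one dimension at a time. *)
Lemma riesz_extension (T : set 'rV[R]_d) w n (V : 'M[R]_d) u :
  (forall x y, T x -> T y -> T (x + y)) ->
  (forall (a : R) x, 0 <= a -> T x -> T (a *: x)) ->
  (forall y, T y -> exists a, T (a *: w - y)) ->
  (d - \rank V <= n)%N -> (w <= V)%MS -> dotv u w = 1 ->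
  (forall v, (v <= V)%MS -> T v -> 0 <= dotv u v) ->
  exists u', dotv u' w = 1 /\ forall t, T t -> 0 <= dotv u' t.
Proof.
move=> TD TZ Tw; elim: n V u => [|n IH] V u Vn wV uw uV.
  by exists u; split => // t; apply: uV; exact: full_rank_submx.
have [TV|/existsNP[y /not_implyP[Ty /negP yV]]] :=
    pselect (forall t, T t -> (t <= V)%MS).
  by exists u; split => // t Tt; apply: uV => //; exact: TV.
have [g [Vg gy]] := notin_submx_dotv _ _ _ yV.
have gV v : (v <= V)%MS -> dotv g v = 0 by exact: dotv_submx_eq0.
(* In the order of the cone [T], [S1] holds the values of [u] at the elements of [V] below [y];
   values at elements above [y] bound it. Its supremum [c] is the value given to [y], by adding a
   multiple of [g], which vanishes on [V] and is 1 at [y]. *)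
pose S1 := [set r | exists v, [/\ (v <= V)%MS, T (y - v) & r = dotv u v]].
have [b Tb] := Tw y Ty.
have S1le v : (v <= V)%MS -> T (v - y) -> ubound S1 (dotv u v).
  move=> vV Tv _ [v' [v'V Tv' ->]].
  rewrite -subr_ge0 -dotvBr; apply: uV.
    by rewrite addmx_sub // eqmx_opp.
  by have := TD _ _ Tv Tv'; rewrite addrA subrK.
have S10 : S1 0 by exists 0; rewrite sub0mx subr0 dotv0r.
have bV : (b *: w <= V)%MS by rewrite scalemx_sub.
have supS1 : has_sup S1.
  by split; [exists 0|exists (dotv u (b *: w)); exact: S1le].
pose c := sup S1.
apply: (IH (V + y)%MS (u + (c - dotv u y) *: g)).
- exact: rank_adds_row.
- exact: submx_trans (addsmxSl _ _).
- by rewrite dotvDl dotvZl (gV w) // mulr0 addr0.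
move=> _ /sub_addsmxP[[p q] /= ->]; set v := p *m V.
have vV : (v <= V)%MS by exact: submxMl.
rewrite (mx11_scalar q) mul_scalar_mx; set a := q 0 0 => Tva.
have -> : dotv (u + (c - dotv u y) *: g) (v + a *: y) = dotv u v + a * c.
  by rewrite dotvDl dotvZl !dotvDr !dotvZr gy gV //; ring.
have [a0|a0|a0] := ltgtP a 0.
- have a1 : 0 < (- a)^-1 by rewrite invr_gt0; lra.
  have : c <= dotv u ((- a)^-1 *: v).
    apply: ge_sup => //; first by exists 0.
    apply: S1le; first by rewrite scalemx_sub.
    have := TZ _ _ (ltW a1) Tva; congr (T _).
    by apply/rowP => i; rewrite !mxE; field; apply/eqP; lra.
  rewrite dotvZr ler_pdivlMl; lra.
- have a1 : 0 < a^-1 by rewrite invr_gt0.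
  have : dotv u (- (a^-1 *: v)) <= c.
    apply: ub_le_sup; first by case: supS1.
    exists (- (a^-1 *: v)); split => //.
      by rewrite eqmx_opp scalemx_sub.
    have := TZ _ _ (ltW a1) Tva; congr (T _).
    by apply/rowP => i; rewrite !mxE; field; apply/eqP; lra.
  rewrite dotvNr dotvZr lerNl ler_pdivlMl //; lra.
- rewrite a0 mul0r addr0; apply: uV => //.
  by move: Tva; rewrite a0 scale0r addr0.
Qed.

(** Let [T] be the cone generated by [K - z], and [w = z0 - z] with [z0] in the relative core. Then
    [w] is an order unit of [T], and [- w] is not in [T]: otherwise [z] would be a convex
    combination of [z0], with positive weight, and a point of [K], hence in the relative core. So
    the functional equal to 1 at [w] is nonnegative on [T] along the line of [w], and extends. *)
Lemma separation K z : is_convex K -> K !=set0 -> ~ rel_core K z ->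
  exists u, (forall x, K x -> dotv u x <= dotv u z) /\
    (exists2 x, K x & dotv u x < dotv u z).
Proof.
move=> cK K0 zK; have [z0 z0K] := rel_core_nonempty _ cK K0.
have [Kz0 Kz0P] := z0K; move/is_convexP: (cK) => cK'.
pose T := [set v | exists t x, [/\ (0 : R) <= t, K x & v = t *: (x - z)]].
have TZ (a : R) x : 0 <= a -> T x -> T (a *: x).
  move=> a0 [t [y [t0 Ky ->]]]; exists (a * t), y.
  by rewrite mulr_ge0 // scalerA.
have TD x y : T x -> T y -> T (x + y).
  move=> [t [p [t0 Kp ->]]] [s [q [s0 Kq ->]]].
  have [st0|st0] := eqVneq (t + s) 0.
    have -> : t = 0 by lra.
    have -> : s = 0 by lra.
    by exists 0, p; rewrite !scale0r addr0.
  have st : 0 < t + s by rewrite lt_neqAle eq_sym st0 addr_ge0.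
  exists (t + s), ((t / (t + s)) *: p + (1 - t / (t + s)) *: q); split.
  - lra.
  - apply: cK' => //; first by rewrite divr_ge0 //; lra.
    by rewrite ler_pdivrMr //; lra.
  - by apply/rowP => i; rewrite !mxE; field; apply/eqP; lra.
pose w := z0 - z.
have Tw : T w by exists 1, z0; rewrite scale1r.
have w_unit y : T y -> exists a, T (a *: w - y).
  move=> [t [x [t0 Kx ->]]]; have [e e0 Kx'] := Kz0P x Kx.
  exists (t / e * (1 + e)).
  exists (t / e), (z0 + e *: (z0 - x)); split => //.
    by rewrite divr_ge0 //; lra.
  by apply/rowP => i; rewrite !mxE; field; apply/eqP; lra.
have Tnw : ~ T (- w).
  move=> [t [x [t0 Kx wx]]]; apply: zK.
  have -> : z = (1 + t)^-1 *: z0 + (1 - (1 + t)^-1) *: x.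
    have zx i : z 0 i - z0 0 i = t * (x 0 i - z 0 i).
      by move/rowP: wx => /(_ i); rewrite !mxE; lra.
    apply/rowP => i; rewrite !mxE; have := zx i => zxi.
    have t1 : 1 + t != 0 by apply/eqP; lra.
    apply: (mulfI t1); rewrite mulrDr mulrA mulfV // mul1r mulrA mulrBr.
    rewrite mulfV //.
    lra.
  apply: rel_core_segment => //; first by rewrite invr_gt0; lra.
  by rewrite invf_le1; lra.
have w0 : w != 0.
  by apply/eqP => w0; apply: Tnw; move: Tw; rewrite w0 oppr0.
have ww : 0 < dotv w w by rewrite lt_neqAle eq_sym dotvv_eq0 w0 dotvv_ge0.
have [|||u [uw uT]] := riesz_extension T w _ <<w>>%MS ((dotv w w)^-1 *: w)
    TD TZ w_unit (leqnn _).
- by rewrite genmxE.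
- by rewrite dotvZl mulVf // gt_eqF.
- move=> v; rewrite genmxE => /sub_rVP[a ->] Ta.
  rewrite dotvZl dotvZr mulrCA mulVf ?gt_eqF // mulr1 leNgt; apply/negP => a0.
  apply: Tnw; have -> : - w = (- a)^-1 *: (a *: w).
    by rewrite scalerA invrN mulNr mulVf ?scaleN1r // lt_eqF.
  by apply: TZ => //; rewrite invr_ge0; lra.
have uN v : dotv (- u) v = - dotv u v by rewrite dotvC dotvNr dotvC.
exists (- u); split=> [x Kx|].
  rewrite !uN lerN2 -subr_ge0 -dotvBr.
  by apply: uT; exists 1, x; rewrite scale1r.
by exists z0 => //; rewrite !uN ltrN2 -subr_gt0 -dotvBr uw ltr01.
Qed.

(** Take [z] in the relative core of [F]. If [z] were in that of [K], segments prolonged beyond [z]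
    would put all of [K] into [F]. So [z] is separated from [K]; the functional is maximal at [z],
    hence constant on [F], where segments can be prolonged beyond [z]. *)
Lemma face_support K F : is_convex K -> face K F -> F <> K ->
  exists u a, [/\ forall x, K x -> dotv u x <= a,
    forall x, F x -> dotv u x = a & exists2 x, K x & dotv u x < a].
Proof.
move=> cK [F0 cF FK Fext] FnK.
have [z [Fz zF]] := rel_core_nonempty _ cF F0.
have K0 : K !=set0 by case: F0 => x /FK Kx; exists x.
have zK : ~ rel_core K z.
  move=> [Kz zK]; apply: FnK; apply/seteqP; split => // y Ky.
  have [e e0 Ke] := zK y Ky.
  have e1 : 0 < 1 + e by lra.
  have := Fext (z + e *: (z - y)) y (1 + e)^-1 Ke Ky.
  rewrite invr_gt0 invf_lt1 //; case=> //; first lra.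
  have <- : z = (1 + e)^-1 *: (z + e *: (z - y)) + (1 - (1 + e)^-1) *: y.
    by apply/rowP => i; rewrite !mxE; field; apply/eqP; lra.
  by [].
have [u [uK uK']] := separation _ _ cK K0 zK.
exists u, (dotv u z); split => // y Fy; apply/eqP.
rewrite eq_le uK /=; last exact: FK.
have [e e0 Fe] := zF y Fy; have := uK _ (FK _ Fe).
by rewrite dotvDr dotvZr dotvBr; nra.
Qed.

End convexity.

(** * The closure of the convex core *)

Section topology.
Context {R : realType} {d : nat}.
Implicit Types (u v w x y z : 'rV[R]_d) (A : set 'rV[R]_d).

Lemma dotv_continuous u : continuous (dotv u).
Proof.
apply: (@continuous_big R _ +%R 0 predT add_continuous _ (index_enum 'I_d)).
move=> i _ x; apply: (@continuousM R _ (fun=> u ord0 i) (fun v => v ord0 i)).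
  exact: cst_continuous.
exact: coord_continuous.
Qed.

Lemma cvg_dotvl {T : Type} (F : set_system T) {FF : Filter F}
    (f : T -> 'rV[R]_d) u v :
  f t @[t --> F] --> u -> dotv (f t) v @[t --> F] --> dotv u v.
Proof.
move=> fu; rewrite dotvC; under eq_fun do rewrite dotvC.
exact: (cvg_comp _ _ fu (dotv_continuous _ _)).
Qed.

Lemma closed_hyperplane u (a : R) : closed [set x | dotv u x = a].
Proof.
have /continuous_closedP := dotv_continuous u.
by move=> /(_ [set a] (@closed_eq R a)).
Qed.

Lemma closed_halfspace u (a : R) : closed [set x | dotv u x <= a].
Proof.
have /continuous_closedP := dotv_continuous u.
by move=> /(_ [set x | x <= a] (@closed_le R a)).
Qed.

Lemma measurable_dotv u : measurable_fun setT (dotv u).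
Proof.
apply: (measurability _ (RGenOpens.measurableE R)).
move=> _ [_ [a [b ->] <-]]; rewrite setTI; apply: sub_gen_smallest.
have /continuousP := dotv_continuous u.
by apply; exact: interval_open.
Qed.

Lemma measurable_halfspace u (a : R) : measurable [set x | dotv u x <= a].
Proof. by apply: closed_measurable_mx; exact: closed_halfspace. Qed.

Lemma measurable_open_halfspace u (a : R) : measurable [set x | a < dotv u x].
Proof.
have -> : [set x | a < dotv u x] = ~` [set x | dotv u x <= a].
  by apply/seteqP; split=> x /=; rewrite ltNge => /negP.
by apply: measurableC; exact: measurable_halfspace.
Qed.

Lemma measurable_closure_mx A : measurable (closure A).
Proof. by apply: closed_measurable_mx; exact: closed_closure. Qed.

Lemma affine_setI A B : affine_set A -> affine_set B -> affine_set (A `&` B).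
Proof. by move=> aA aB x y t [? ?] [? ?]; split; [exact: aA|exact: aB]. Qed.

Lemma affine_hyperplane u (a : R) : affine_set [set x | dotv u x = a].
Proof. by move=> x y t /= xa ya; rewrite dotvDr !dotvZr xa ya; ring. Qed.

Lemma affine_rows A x0 : affine_set A -> A x0 ->
  exists k (M : 'M[R]_(k, d)), forall v, A (x0 + v) <-> (v <= M)%MS.
Proof.
move=> aA Ax0; have [k [M [AM MA]]] := spanning_rows [set v | A (x0 + v)].
exists k, M => v; split=> [/MA //|/submxP[b ->]].
have AZ (a : R) w : A (x0 + w) -> A (x0 + a *: w).
  move=> Aw; have := aA _ _ a Aw Ax0; congr (A _).
  by apply/rowP => i; rewrite !mxE; ring.
(* A sum is the midpoint of the doubled vectors. *)
have AD w1 w2 : A (x0 + w1) -> A (x0 + w2) -> A (x0 + (w1 + w2)).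
  move=> A1 A2; have := aA _ _ 2^-1 (AZ 2 _ A1) (AZ 2 _ A2); congr (A _).
  by apply/rowP => i; rewrite !mxE; field.
rewrite mulmx_sum_row; elim/big_ind : _ => [|w1 w2|i _].
- by rewrite addr0.
- exact: AD.
- exact/AZ/AM.
Qed.

(** An affine set is the intersection of the hyperplanes through one of its points with normals
    orthogonal to its directions. *)
Lemma affine_closed A : affine_set A -> closed A.
Proof.
move=> aA; have [->|/set0P[x0 Ax0]] := eqVneq A set0; first exact: closed0.
have [k [M AM]] := affine_rows _ _ aA Ax0.
have -> : A = \bigcap_(g in [set g : 'rV[R]_d | M *m g^T = 0])
    [set x | dotv g x = dotv g x0].
  apply/seteqP; split=> x.
    rewrite -{1}(subrK x0 x) addrC => /AM xM g /= Mg.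
    by apply/eqP; rewrite -subr_eq0 -dotvBr (dotv_submx_eq0 _ _ _ _ Mg xM).
  move=> xg; rewrite -(subrK x0 x) addrC; apply/AM; apply: contrapT => /negP.
  move=> /notin_submx_dotv[g [Mg gx]].
  by have /eqP := xg g Mg; rewrite -subr_eq0 -dotvBr gx oner_eq0.
by apply: closed_bigI => g _; exact: closed_hyperplane.
Qed.

Lemma affine_measurable A : affine_set A -> measurable A.
Proof. by move=> /affine_closed; exact: closed_measurable_mx. Qed.

End topology.

(** * Convex support and convex core of a finite measure *)

Section convex_core.
Context {R : realType} {d : nat}.
Variable nu : {measure set 'rV[R]_d -> \bar R}.
Implicit Types (x y z : 'rV[R]_d) (A B C D : set 'rV[R]_d).
Local Open Scope ereal_scope.

(** Lindelöf argument: each point of [A] lies in a null ball with rational centre and radius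
    [n.+1%:R^-1], and there are countably many such balls. *)
Lemma null_measure_cover A : measurable A ->
  (forall x, A x -> exists V, [/\ open V, V x & nu V = 0]) -> nu A = 0.
Proof.
move=> mA cA.
pose B (p : 'rV[rat]_d * nat) : set 'rV[R]_d :=
  ball (map_mx ratr p.1 : 'rV[R]_d) p.2.+1%:R^-1%R.
have mB p : measurable (B p).
  by apply: sub_gen_smallest; exact: ball_open.
pose G n := if unpickle n is Some p then if nu (B p) == 0 then B p else set0
  else set0.
have : nu.-negligible (\bigcup_n G n).
  apply: negligible_bigcup => n; rewrite /G; case: unpickle => [p|].
    case: ifPn => [/eqP Bp|_]; last exact: negligible_set0.
    exact/negligibleP.
  exact: negligible_set0.
move/(negligibleS _) => AG; apply/negligibleP => //; apply: AG => x Ax.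
have [V [oV Vx V0]] := cA x Ax.
have /nbhs_ballP[e /= e0 eV] : nbhs x V by exact: open_nbhs_nbhs.
have [n ne] : exists n, (0 + n.+1%:R^-1 < e / 2 :> R)%R.
  by apply: ltr_add_invr; rewrite divr_gt0.
rewrite add0r in ne.
have n0 : (0 < n.+1%:R^-1 :> R)%R by rewrite invr_gt0 ltr0n.
have /choice[q qx] : forall i, exists q : rat,
    (ratr q \in `](x ord0 i - n.+1%:R^-1), (x ord0 i + n.+1%:R^-1)[)%R.
  by move=> i; apply: rat_in_itvoo; rewrite ltrD2l gtrN.
pose p : 'rV[rat]_d * nat := (\row_i q i, n)%R.
have Bpx : B p x.
  split => // i j; rewrite (ord1 i) !mxE /ball /= ltr_norml.
  have := qx j; rewrite in_itv /=; move: (n.+1%:R^-1)%R => r /andP[q1 q2].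
  by apply/andP; split; lra.
exists (pickle p) => //; rewrite /G pickleK.
suff -> : nu (B p) = 0 by rewrite eqxx.
apply: (@subset_measure0 _ _ _ nu _ V) => //; first exact: sub_gen_smallest.
move=> y Bpy; apply: eV; apply: (@le_ball _ _ _ (n.+1%:R^-1 + n.+1%:R^-1)%R).
  by move: ne; move: (n.+1%:R^-1)%R => r; lra.
by apply: ball_triangle Bpy; exact: ball_sym.
Qed.

Hypothesis nufin : nu setT < +oo.

Lemma measure_setT C : measurable C -> nu setT = nu C + nu (~` C).
Proof.
move=> mC; rewrite -measureU ?setUv //; [exact: measurableC|exact: setICr].
Qed.

Lemma full_null C : measurable C -> nu C = nu setT -> nu (~` C) = 0.
Proof.
move=> mC CT; have Cfin : nu C \is a fin_num by rewrite CT ge0_fin_numE.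
move: (measure_setT _ mC); rewrite -CT; move: Cfin.
case: (nu C) => [r| |] // _; case: (nu (~` C)) => [s| |] //.
by move=> [] /esym/eqP; rewrite addrC -subr_eq0 addrK => /eqP ->.
Qed.

Lemma null_full C : measurable C -> nu (~` C) = 0 -> nu C = nu setT.
Proof. by move=> mC C0; rewrite (measure_setT _ mC) C0 adde0. Qed.

Lemma convex_core_sub C : measurable C -> is_convex C -> nu (~` C) = 0 ->
  convex_core nu `<=` C.
Proof.
by move=> mC cC C0; apply: bigcap_inf; split => //; exact: null_full.
Qed.

Lemma convex_core_convex : is_convex (convex_core nu).
Proof. by apply: is_convex_bigcap => C []. Qed.

Let cs := convex_support nu.

Lemma convex_support_closed : closed cs.
Proof. by apply: closed_bigI => C []. Qed.

Lemma convex_support_null : nu (~` cs) = 0.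
Proof.
have ccs := convex_support_closed.
apply: null_measure_cover => [|x].
  by apply: measurableC; exact: closed_measurable_mx.
move=> /existsNP[C /not_implyP[[cC _ C1] xC]].
exists (~` C); split => //; first exact: closed_openC.
exact: full_null (closed_measurable_mx cC) C1.
Qed.

Lemma null_nonempty C : nu setT <> 0 -> nu (~` C) = 0 -> C !=set0.
Proof.
move=> nu0 C0; apply/set0P/eqP => C00; apply: nu0.
by rewrite -C0 C00 setC0.
Qed.

(** If a convex Borel set [C] of full measure missed [x], separating [x] from [C] within the support
    would give a closed half-space of full measure with [x] on its boundary. It contains the
    support, yet a segment of the support prolonged beyond [x] leaves it. *)
Lemma rel_core_support_sub : nu setT <> 0 -> rel_core cs `<=` convex_core nu.
Proof.
move=> nu0 x [csx xcs] C [mC cC /(full_null _ mC) C0]; apply: contrapT => Cx.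
have mcs : measurable cs by exact: closed_measurable_mx convex_support_closed.
have ccs : is_convex cs by apply: is_convex_bigcap => ? [].
have mK : measurable (C `&` cs) by exact: measurableI.
have K0 : nu (~` (C `&` cs)) = 0.
  rewrite setCI; apply: null_set_setU => //; [exact: measurableC..|].
  exact: convex_support_null.
have [||//|u [uK [y [Cy csy] uy]]] := separation (C `&` cs) x.
- exact: is_convexI.
- exact: null_nonempty.
- by case=> -[].
have csH : cs `<=` [set y | dotv u y <= dotv u x]%R.
  apply: bigcap_inf; split.
  - exact: closed_halfspace.
  - exact: convex_halfspace.
  have mH := measurable_halfspace u (dotv u x).
  apply: null_full => //; apply: subset_measure0 K0; [exact: measurableC..|].
  exact: subsetC.
have [e e0 /csH /=] := xcs y csy.
by rewrite dotvDr dotvZr dotvBr; nra.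
Qed.

(** The relative core of the support is contained in the convex core and dense in the support: each
    [y] of the support is a limit of points [s *: z + (1 - s) *: y] of the relative core. *)
Lemma convex_core_closure_null : nu (~` closure (convex_core nu)) = 0.
Proof.
have mcl := measurable_closure_mx (convex_core nu).
have [nu0|/eqP nu0] := eqVneq (nu setT) 0.
  by apply: subset_measure0 nu0 => //; exact: measurableC.
have mcs : measurable cs by exact: closed_measurable_mx convex_support_closed.
have ccs : is_convex cs by apply: is_convex_bigcap => ? [].
apply: subset_measure0 convex_support_null; [exact: measurableC..|].
apply: subsetC => y csy.
have [z zcs] := rel_core_nonempty _ ccs
  (null_nonempty _ nu0 convex_support_null).
have cvgy : (s *: z + (1 - s) *: y)%R @[s --> (0 : R)^'+] --> y.
  have yE : y = (0 *: z + (1 - 0) *: y)%R.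
    by rewrite scale0r add0r subr0 scale1r.
  rewrite [X in _ --> X]yE.
  apply: cvg_within_filter; apply: cvgD.
    by apply: cvgZr_tmp; exact: cvg_id.
  by apply: cvgZr_tmp; apply: cvgB; [exact: cvg_cst|exact: cvg_id].
move=> B yB; have := cvgy B yB => nearB.
near (0 : R)^'+ => s.
exists (s *: z + (1 - s) *: y)%R; split; last by near: s.
apply: rel_core_support_sub => //; apply: rel_core_segment => //.
by near: s; apply: nbhs_right_le.
Unshelve. all: by end_near. Qed.

End convex_core.

(** * Flats and faces *)

Lemma ge0_integral_mrestr d (T : measurableType d) (R : realType)
    (mu : {measure set T -> \bar R}) (D B : set T) (mD : measurable D)
    (f : T -> \bar R) :
  measurable B -> measurable_fun B f -> (forall x, B x -> (0 <= f x)%E) ->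
  (\int[mrestr mu mD]_(x in B) f x = \int[mu]_(x in B `&` D) f x)%E.
Proof.
move=> mB mf f0.
rewrite (@ge0_negligible_integral _ _ _ _ B (~` D)) //; last 2 first.
- exact: measurableC.
- by rewrite /= /mrestr setICl measure0.
rewrite setDE setCK; apply: eq_measure_integral => A mA AD.
by rewrite /= /mrestr setIidl // => x /AD[].
Qed.

Section flat.
Context {R : realType} {d : nat}.
Variable mu : {measure set 'rV[R]_d -> \bar R}.
Hypothesis mufin : (mu setT < +oo)%E.
Implicit Types (x y z u : 'rV[R]_d) (A B C D F : set 'rV[R]_d).

(* The extremality is asked for in a convex set D of full measure rather than
   in the convex core, which may be a null set: this makes flats stable under
   countable intersections and under passing to supporting hyperplanes. *)
Definition flat A := affine_set A /\ exists D,
  [/\ measurable D, is_convex D, mu (~` D) = 0%E &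
    forall x y (t : R), D x -> D y -> 0 < t -> t < 1 ->
      A (t *: x + (1 - t) *: y) -> A x /\ A y].

Lemma flatT : flat setT.
Proof.
split; first by [].
by exists setT; split => //; rewrite setCT measure0.
Qed.

(** All the extremality conditions hold together in the intersection of the sets [D_ n], which still
    has full measure. *)
Lemma flat_liminf (A_ : nat -> set 'rV[R]_d) : (forall n, flat (A_ n)) ->
  flat [set x | \forall n \near \oo, A_ n x].
Proof.
move=> fA; split.
  move=> x y t /= Ax Ay; near=> n; have [aA _] := fA n.
  by apply: aA; near: n.
have /choice[D_ DP] : forall n, exists D, [/\ measurable D, is_convex D,
    mu (~` D) = 0%E & forall x y (t : R), D x -> D y -> 0 < t -> t < 1 ->
      A_ n (t *: x + (1 - t) *: y) -> A_ n x /\ A_ n y].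
  by move=> n; have [_] := fA n.
exists (\bigcap_n D_ n); split.
- by apply: bigcapT_measurable => n; have [] := DP n.
- apply/is_convexP => x y t Dx Dy t0 t1 n _.
  have [_ /is_convexP cD _ _] := DP n.
  by apply: cD => //; [exact: Dx|exact: Dy].
- rewrite setC_bigcap; apply/negligibleP.
    by apply: bigcupT_measurable => n; apply: measurableC; have [] := DP n.
  apply: negligible_bigcup => n; have [mD _ D0 _] := DP n.
  by apply/negligibleP => //; exact: measurableC.
- move=> x y t Dx Dy t0 t1 /= Axy.
  split; near=> n; have [_ _ _ /(_ x y t)] := DP n.
    by case=> //; [exact: Dx|exact: Dy|near: n].
  by case=> //; [exact: Dx|exact: Dy|near: n].
Unshelve. all: by end_near. Qed.

Lemma flat_hyperplane A u (a : R) : flat A ->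
  mu (A `&` [set x | a < dotv u x]) = 0%E ->
  flat (A `&` [set x | dotv u x = a]).
Proof.
move=> [aA [D [mD /is_convexP cD D0 Dext]]] Aa; split.
  exact: affine_setI aA (affine_hyperplane _ _).
have mA : measurable A by exact: affine_measurable.
have mH := measurable_halfspace u a.
(* Discard from [D] the points of [A] beyond the hyperplane, a null set. The rest is convex: if a
   point strictly between two others falls in [A], extremality puts both endpoints in [A], hence in
   the half-space. *)
exists (D `&` (~` A `|` [set x | dotv u x <= a])); split.
- apply: measurableI => //; apply: measurableU => //; exact: measurableC.
- apply/is_convexP => x y t [Dx Ax] [Dy Ay] t0 t1; split; first exact: cD.
  have [->|tn0] := eqVneq t 0; first by rewrite scale0r add0r subr0 scale1r.
  have [->|tn1] := eqVneq t 1; first by rewrite subrr scale0r addr0 scale1r.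
  have {}t0 : 0 < t by rewrite lt_neqAle eq_sym tn0.
  have {}t1 : t < 1 by rewrite lt_neqAle tn1.
  apply: contrapT => /not_orP[/contrapT Axy /= Hxy]; apply: Hxy.
  have [Ax' Ay'] := Dext x y t Dx Dy t0 t1 Axy.
  case: Ax => // /= Hx; case: Ay => // /= Hy.
  by rewrite dotvDr !dotvZr; nra.
- have -> : ~` (D `&` (~` A `|` [set x | dotv u x <= a])) =
      ~` D `|` (A `&` [set x | a < dotv u x]).
    rewrite setCI setCU setCK; congr (_ `|` (_ `&` _)).
    by apply/seteqP; split=> x /=; rewrite ltNge => /negP.
  apply: null_set_setU => //; first exact: measurableC.
  by apply: measurableI => //; exact: measurable_open_halfspace.
- move=> x y t [Dx Hx] [Dy Hy] t0 t1 [Axy /=].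
  have [Ax Ay] := Dext x y t Dx Dy t0 t1 Axy.
  case: Hx => // /= Hx; case: Hy => // /= Hy.
  by rewrite dotvDr !dotvZr => xya; split; split => //=; nra.
Qed.

(* The restriction of mu to A is carried by the closure of its own convex core,
   which is contained in that of mu. *)
Lemma affine_core_closure_null A : affine_set A ->
  mu (A `\` closure (A `&` convex_core mu)) = 0%E.
Proof.
move=> aA; have mA := affine_measurable _ aA.
pose nu : {measure set 'rV[R]_d -> \bar R} := mrestr mu mA.
have nufin : (nu setT < +oo)%E.
  rewrite /nu /= /mrestr setTI; apply: le_lt_trans mufin.
  by apply: le_measure; rewrite ?inE.
have sub : convex_core nu `<=` A `&` convex_core mu.
  move=> x nux; split.
    apply: convex_core_sub nux => //; first exact: affine_convex.
    by rewrite /nu /= /mrestr setICl measure0.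
  move=> C [mC cC CT]; have C0 := full_null _ mufin _ mC CT.
  apply: convex_core_sub nux => //.
  have mCc : measurable (~` C) by exact: measurableC.
  apply: (subset_measure0 _ mCc _ C0); first exact: measurableI.
  exact: subIsetl.
have := convex_core_closure_null _ nufin; rewrite /nu /= /mrestr.
apply: subset_measure0.
- by apply: measurableD => //; exact: measurable_closure_mx.
- by apply: measurableI => //; apply: measurableC; exact: measurable_closure_mx.
move=> x [Ax clx]; split => // /(closureS sub) //.
Qed.

(** The trace is nonempty because its closure carries [mu] on [A]; extremality is inherited from
    [D], which contains the convex core. *)
Lemma flat_face A : flat A -> mu A <> 0%E ->
  face (convex_core mu) (A `&` convex_core mu).
Proof.
move=> [aA [D [mD cD D0 Dext]]] A0; split.
- apply/set0P/eqP => AK0; apply: A0.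
  have := affine_core_closure_null _ aA.
  by rewrite AK0 closure0 setD0.
- by apply: is_convexI; [exact: affine_convex|exact: convex_core_convex].
- exact: subIsetr.
- move=> x y t Kx Ky t0 t1 [Axy _].
  have KD : convex_core mu `<=` D by exact: convex_core_sub.
  by have [] := Dext x y t (KD _ Kx) (KD _ Ky) t0 t1 Axy.
Qed.

Lemma closure_sub_affine A F : affine_set A -> F `<=` A -> closure F `<=` A.
Proof.
by move=> /affine_closed /closure_id {2}-> FA; exact: closureS.
Qed.

(** Start from the whole space. While [F] is a proper face of the trace of [A] on the core, cut [A]
    by a supporting hyperplane of that trace; the part of [A] beyond it is null, being outside the
    closure of the trace. *)
Lemma face_flat F : face (convex_core mu) F -> exists A,
  [/\ flat A, closure F `<=` A & mu (A `\` closure F) = 0%E].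
Proof.
set K := convex_core mu => fF; have [[x Fx] cF FK Fext] := fF.
(* The rows of [U] are functionals constant on [A]. The supporting functional is not constant on
   [A], so each cut raises the rank of [U]. *)
suff: forall n A (U : 'M[R]_d), (d - \rank U <= n)%N -> flat A -> F `<=` A ->
    (forall x y g, A x -> A y -> (g <= U)%MS -> dotv g x = dotv g y) ->
    exists A, [/\ flat A, closure F `<=` A & mu (A `\` closure F) = 0%E].
  move=> /(_ d setT 0); apply => //; first exact: leq_subr.
    exact: flatT.
  by move=> y z g _ _; rewrite submx0 => /eqP ->; rewrite !(dotvC 0) !dotv0r.
have step A (U : 'M[R]_d) : flat A -> F `<=` A -> F <> A `&` K ->
    (forall x y g, A x -> A y -> (g <= U)%MS -> dotv g x = dotv g y) ->
    exists u a, [/\ ~~ (u <= U)%MS, forall y, (A `&` K) y -> dotv u y <= a &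
      forall y, F y -> dotv u y = a].
  move=> [aA _] FA AKF UA.
  have cAK : is_convex (A `&` K).
    by apply: is_convexI; [exact: affine_convex|exact: convex_core_convex].
  have fFA : face (A `&` K) F.
    split => [|//|y Fy|y z t [_ Ky] [_ Kz]]; [by exists x| |exact: Fext].
    by split; [exact: FA|exact: FK].
  have [u [a [uK uF [y [Ay _] uy]]]] := face_support _ _ cAK fFA AKF.
  exists u, a; split => //; apply/negP => /(UA x y _ (FA _ Fx) Ay)/eqP.
  by rewrite (uF _ Fx) gt_eqF.
elim=> [|n IH] A U Un fA FA UA; have [aA _] := fA;
    have [AKF|/eqP AKF] := eqVneq F (A `&` K);
    try by exists A; split; rewrite ?AKF //; [
      apply: closure_sub_affine => //; exact: subIsetl|
      exact: affine_core_closure_null].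
  have [u [a [uU _ _]]] := step A U fA FA AKF UA.
  by rewrite full_rank_submx in uU.
have [u [a [uU uK uF]]] := step A U fA FA AKF UA.
apply: (IH (A `&` [set x | dotv u x = a]) (U + u)%MS).
- exact: rank_adds_row.
- apply: flat_hyperplane => //.
  apply: subset_measure0 (affine_core_closure_null _ aA).
  + apply: measurableI; first exact: affine_measurable.
    exact: measurable_open_halfspace.
  + apply: measurableD; first exact: affine_measurable.
    exact: measurable_closure_mx.
  + move=> z [Az uz]; split => // clz.
    have : closure [set x | dotv u x <= a] z by apply: closureS clz => ? /uK.
    rewrite -(proj1 (closure_id _) (closed_halfspace u a)) /=.
    by rewrite leNgt => /negP.
- by move=> z Fz; split; [exact: FA|exact: uF].
- exact: constant_adds_row.
Qed.

End flat.

(** * Members of the extension as exponential densities on flats *)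

Section flat_density.
Context {R : realType} {d : nat}.
Variable mu : {measure set 'rV[R]_d -> \bar R}.
Hypothesis mufin : (mu setT < +oo)%E.
Implicit Types (x y z u th : 'rV[R]_d) (A B C D F : set 'rV[R]_d).
Implicit Type P : probability 'rV[R]_d R.
Local Open Scope ereal_scope.

(** Here [th] is not confined to the directions of a face, and [c] is determined by the total mass
    of [P]. *)
Definition flat_density P A th (c : R) := flat mu A /\
  forall B, measurable B ->
    P B = \int[mu]_(x in B `&` A) (expR (dotv th x - c))%:E.

Lemma measurable_expR_dotv th (c : R) A :
  measurable_fun A (fun x => expR (dotv th x - c)).
Proof.
apply: measurable_funTS; apply: measurableT_comp => //.
by apply: measurable_funB => //; exact: measurable_dotv.
Qed.

Lemma integral_closure_flat A F (f : 'rV[R]_d -> R) B :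
  flat mu A -> closure F `<=` A -> mu (A `\` closure F) = 0 ->
  measurable B -> measurable_fun setT f -> (forall x, 0 <= f x)%R ->
  \int[restr_closure mu F]_(x in B) (f x)%:E = \int[mu]_(x in B `&` A) (f x)%:E.
Proof.
move=> [aA _] FA AF mB mf f0; have mA := affine_measurable _ aA.
have mF := measurable_closure_mx F.
have mf' : forall E, measurable_fun E (fun x => (f x)%:E).
  by move=> E; apply/measurable_EFinP; exact: measurable_funTS.
rewrite ge0_integral_mrestr // => [|x _]; last by rewrite lee_fin.
rewrite [RHS](@ge0_negligible_integral _ _ _ _ _ (A `\` closure F)) //.
- congr (integral mu _ _); apply/seteqP; split=> x.
    by move=> [Bx Fx]; split; [split => //; exact: FA|case].
  move=> [[Bx Ax] Fx]; split => //; apply: contrapT => nFx.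
  by apply: Fx.
- exact: measurableD.
- exact: measurableI.
- by move=> x _; rewrite lee_fin.
Qed.

Lemma extension_flat_density P : extension mu P ->
  exists A th c, flat_density P A th c.
Proof.
move=> [F fF [th [_ _ Pth]]]; have [A [fA FA AF]] := face_flat _ mufin _ fF.
exists A, th, (fine (log_laplace (restr_closure mu F) th)); split => // B mB.
rewrite Pth // /tilt; apply: integral_closure_flat => //.
exact: measurable_expR_dotv.
Qed.

Lemma affine_hull_affine F : affine_set (affine_hull F).
Proof.
by move=> x y t Fx Fy C CF; apply: (CF.1); [exact: Fx C CF|exact: Fy C CF].
Qed.

(** To bring the parameter into [lin F], project [th] orthogonally onto the directions of the affine
    hull of [F]. The dropped part is constant on [closure F] and goes into the normalizing
    constant. *)
Lemma flat_density_extension P A th c : flat_density P A th c -> extension mu P.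
Proof.
move=> [fA PA]; have [aA _] := fA; have mA := affine_measurable _ aA.
have mexp th' c' E := measurable_expR_dotv th' c' E.
have mexpE th' c' E : measurable_fun E (fun x => (expR (dotv th' x - c'))%:E).
  by apply/measurable_EFinP; exact: mexp.
have muA : mu A <> 0.
  move=> muA; have : P setT = 0.
    by rewrite PA // setTI null_set_integral.
  by rewrite probability_setT => /eqP; rewrite onee_eq0.
pose F := A `&` convex_core mu.
have fF : face (convex_core mu) F by exact: flat_face.
have FA : closure F `<=` A by apply: closure_sub_affine => //; exact: subIsetl.
have AF : mu (A `\` closure F) = 0 by exact: affine_core_closure_null.
have [[x0 Fx0] _ _ _] := fF.
have hullF : F `<=` affine_hull F by exact: sub_gen_smallest.
have [k [M MF]] := affine_rows _ _ (affine_hull_affine F) (hullF _ Fx0).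
have [th' [th'M Mth]] := submx_orth_decomp _ M th.
pose b := dotv (th - th') x0.
have thb x : closure F x -> dotv th x = (dotv th' x + b)%R.
  suff /(_ x) : closure F `<=` [set x | dotv (th - th') x = b]%R.
    by move=> /[apply] /=; rewrite dotvBl => <-; rewrite addrC subrK.
  apply: closure_sub_affine; first exact: affine_hyperplane.
  move=> y Fy; apply/eqP; rewrite /= -subr_eq0 -dotvBr dotvC; apply/eqP.
  rewrite dotvC; apply: dotv_submx_eq0 Mth _.
  by apply/MF; rewrite addrC subrK; exact: hullF.
have restrE th2 c2 B : measurable B ->
    \int[restr_closure mu F]_(x in B) (expR (dotv th2 x - c2))%:E =
    \int[mu]_(x in B `&` A) (expR (dotv th2 x - c2))%:E.
  by move=> mB; apply: integral_closure_flat.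
have closureE B (f : 'rV[R]_d -> \bar R) : measurable B ->
    measurable_fun B f -> (forall x, B x -> 0 <= f x) ->
    \int[restr_closure mu F]_(x in B) f x =
    \int[mu]_(x in B `&` closure F) f x.
  by move=> mB mf f0; exact: ge0_integral_mrestr.
have Lth' : log_laplace (restr_closure mu F) th' = (c - b)%:E.
  have -> : (c - b)%:E = lne (expR (c - b))%:E.
    by rewrite lne_EFin ?expR_gt0 // expRK.
  rewrite /log_laplace; congr lne.
  transitivity (\int[restr_closure mu F]_(x in setT)
      ((expR (c - b))%:E * (expR (dotv th x - c))%:E)).
    rewrite closureE //; last first.
      apply/measurable_EFinP; apply: measurableT_comp => //.
      exact: measurable_dotv.
    rewrite closureE //; last by apply: measurable_funeM; exact: mexpE.
    apply: eq_integral => x /set_mem[_ /thb thx].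
    by rewrite -EFinM -expRD thx; congr (expR _)%:E; ring.
  rewrite ge0_integralZl //.
  by rewrite restrE // -PA // probability_setT mule1.
exists F => //; exists th'; split.
- by rewrite Lth' ltry.
- by exists x0; [exact: hullF|exact/MF].
move=> B mB; rewrite PA // /tilt Lth' /= -restrE //.
rewrite !closureE //.
apply: eq_integral => x /set_mem[_ /thb thx].
by rewrite thx; congr (expR _)%:E; ring.
Qed.

End flat_density.

(** * Densities of limits in variation *)

Section variation_convergence.
Context d (T : measurableType d) (R : realType).
Local Open Scope ereal_scope.

Lemma abse_charge_total_variation (nu : {charge set T -> \bar R}) A :
  measurable A -> `|nu A| <= charge_total_variation nu.
Proof.
move=> mA; rewrite /charge_total_variation.
move: (projT2 (cid (projT2 (cid (Hahn_decomposition nu))))) => nuPN.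
apply: (@le_trans _ _ (charge_variation nuPN A)).
  exact: (abse_charge_variation nuPN mA).
by apply: le_measure; rewrite ?inE.
Qed.

Lemma le_variation_distance (P Q : probability T R) A : measurable A ->
  `|P A - Q A| <= variation_distance P Q.
Proof. by move=> mA; exact: abse_charge_total_variation. Qed.

Variable mu : {measure set T -> \bar R}.
Variables (f_ : nat -> T -> R) (P_ : nat -> probability T R)
  (P : probability T R).
Hypothesis mf : forall n, measurable_fun setT (f_ n).
Hypothesis f0 : forall n x, (0 <= f_ n x)%R.
Hypothesis Pf : forall n A, measurable A ->
  P_ n A = \int[mu]_(x in A) (f_ n x)%:E.
Hypothesis PP : forall n A, measurable A ->
  `|P_ n A - P A| <= (1 / (2 ^ n.+1)%:R)%:E.

Let g n x := `|f_ n.+1 x - f_ n x|%R.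

Let mfE n A : measurable_fun A (fun x => (f_ n x)%:E).
Proof. by apply/measurable_EFinP; exact: measurable_funTS. Qed.

Let g0 n x : (0 <= g n x)%R. Proof. exact: normr_ge0. Qed.

Let mg n : measurable_fun setT (g n).
Proof. by apply: measurableT_comp => //; exact: measurable_funB. Qed.

Let integrable_f n A : measurable A -> mu.-integrable A (fun x => (f_ n x)%:E).
Proof.
move=> mA; apply/integrableP; split => //.
under eq_integral do rewrite gee0_abs ?lee_fin //.
by rewrite -Pf // ltey_eq fin_num_measure.
Qed.

Let integral_diff n m A : measurable A ->
  \int[mu]_(x in A) (f_ n x - f_ m x)%:E <=
  (1 / (2 ^ n.+1)%:R)%:E + (1 / (2 ^ m.+1)%:R)%:E.
Proof.
move=> mA; under eq_integral do rewrite EFinB.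
rewrite integralB_EFin // -?Pf //; try exact: integrable_f.
have Pn := PP n _ mA; have Pm := PP m _ mA.
have fin (Q : probability T R) : Q A \is a fin_num by exact: fin_num_measure.
move: Pn Pm.
rewrite -(fineK (fin (P_ n))) -(fineK (fin (P_ m))) -(fineK (fin P)).
rewrite -!EFinB -!EFinD !lee_fin => Pn Pm.
have := ler_norm (fine (P_ n A) - fine (P A)).
have := ler_norm (- (fine (P_ m A) - fine (P A))); rewrite normrN.
lra.
Qed.

(** Split according to the sign of [f_ n.+1 - f_ n]: on each piece the integral is a difference of
    probabilities. The two pieces add up to 3 times [1 / 2 ^ n.+1], whence the 4. *)
Let integral_g n : \int[mu]_x (g n x)%:E <= (4 / (2 ^ n.+1)%:R)%:E.
Proof.
pose B := [set x | f_ n x <= f_ n.+1 x]%R.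
have mB : measurable B.
  rewrite -[B]setTI.
  have /(_ measurableT [set true]) := measurable_fun_ler (mf n) (mf n.+1).
  by apply.
have mBc : measurable (~` B) by exact: measurableC.
rewrite -(setUv B) ge0_integral_setU //; last 3 first.
- by rewrite setUv; apply/measurable_EFinP.
- by move=> x _; rewrite lee_fin.
- exact/disj_setPCl.
have -> : \int[mu]_(x in B) (g n x)%:E =
    \int[mu]_(x in B) (f_ n.+1 x - f_ n x)%:E.
  by apply: eq_integral => x /set_mem Bx; rewrite /g ger0_norm // subr_ge0.
have -> : \int[mu]_(x in ~` B) (g n x)%:E =
    \int[mu]_(x in ~` B) (f_ n x - f_ n.+1 x)%:E.
  apply: eq_integral => x /set_mem /negP; rewrite -ltNge => Bx.
  by rewrite /g distrC gtr0_norm // subr_gt0.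
apply: le_trans (leeD (integral_diff _ _ _ mB) (integral_diff _ _ _ mBc)) _.
rewrite -!EFinD lee_fin expnS natrM invfM.
have : (0 < ((2 ^ n.+1)%:R)^-1 :> R)%R by rewrite invr_gt0 ltr0n expn_gt0.
by move: (_^-1)%R => r; lra.
Qed.

Let h x := \sum_(n <oo) (g n x)%:E.

Let h0 x : 0 <= h x.
Proof. by apply: nneseries_ge0 => n _ _; rewrite lee_fin. Qed.

Let mh : measurable_fun setT h.
Proof.
apply: ge0_emeasurable_sum => [n x _ _|n _]; first by rewrite lee_fin.
exact/measurable_EFinP.
Qed.

Let integrable_h : mu.-integrable setT h.
Proof.
apply/integrableP; split => //.
under eq_integral do rewrite gee0_abs //.
rewrite integral_nneseries //; last 2 first.
- by move=> n; apply/measurable_EFinP.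
- by move=> n x _; rewrite lee_fin.
apply: le_lt_trans (_ : 4%:E < +oo); last exact: ltry.
apply: le_trans (epsilon_trick0 xpredT (ler0n R 4)).
apply: lee_nneseries => [n _ _|n _]; last exact: integral_g.
by apply: integral_ge0 => x _; rewrite lee_fin.
Qed.

(** The rate of convergence makes the sum [h] of the successive differences integrable. Hence the
    telescoping series converges almost everywhere, and [f_ 0 + h] dominates all the densities. *)
Lemma variation_limit_density : exists N (f : T -> R),
  [/\ measurable N, mu N = 0, measurable_fun setT f,
    forall x, ~ N x -> f_ n x @[n --> \oo] --> f x &
    forall A, measurable A -> P A = \int[mu]_(x in A) (f x)%:E].
Proof.
have [N [mN N0 hN]] := integrable_ae measurableT integrable_h.
(* The limit superior is measurable on the whole space; off [N] it is the finite limit. *)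
pose fe x := limn_esup (fun n => (f_ n x)%:E).
have mfe : measurable_fun setT (fine \o fe).
  apply: measurableT_comp; first exact: fine_measurable.
  by apply: measurable_fun_limn_esup => n; exact: mfE.
have gh x n : (\sum_(0 <= k < n) g k x)%:E <= h x.
  rewrite -sumEFin; apply: nneseries_lim_ge => k _ _.
  by rewrite lee_fin.
have fcvg x : ~ N x -> f_ n x @[n --> \oo] --> (fine \o fe) x.
  move=> Nx; have hx : h x \is a fin_num.
    by apply: contrapT => hx; apply/Nx/hN => /(_ Logic.I).
  have cf : cvgn (fun n => f_ n x).
    have -> : (fun n => f_ n x) =
        (fun n => f_ 0%N x + series (telescope (fun n => f_ n x)) n)%R.
      by apply/funext => n; exact: eq_sum_telescope.
    apply: is_cvgD; first exact: is_cvg_cst.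
    apply: normed_cvg; apply: nondecreasing_is_cvgn.
      by apply: nondecreasing_series => k _ _; exact: normr_ge0.
    exists (fine (h x)) => _ [n _ <-]; rewrite /series /= -lee_fin fineK //.
    exact: gh.
  have lf : fe x = (limn (fun n => f_ n x))%:E.
    have ce : (f_ n x)%:E @[n --> \oo] --> (limn (fun n => f_ n x))%:E.
      by apply: cvg_EFin; [exact: nearW|exact: cf].
    rewrite /fe is_cvg_limn_esupE; last by apply/cvg_ex; eexists; exact: ce.
    exact/cvg_lim.
  by rewrite /= lf.
exists N, (fine \o fe); split => // A mA.
have dom x n : `|(f_ n x)%:E| <= (f_ 0%N x)%:E + h x.
  apply: le_trans (leeD2l _ (gh x n)).
  rewrite -EFinD lee_fin (eq_sum_telescope (fun n => f_ n x) n).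
  apply: le_trans (ler_normD _ _) _; rewrite ger0_norm // lerD2l.
  exact: ler_norm_sum.
have [|||||_ _ If] := @dominated_convergence _ _ _ mu A mA
    (fun n x => (f_ n x)%:E) (fun x => (fine (fe x))%:E)
    (fun x => (f_ 0%N x)%:E + h x).
- by move=> n; exact: mfE.
- by apply/measurable_EFinP; exact: measurable_funTS.
- exists N; split => // x; apply: contra_notP => Nx _.
  by apply: cvg_EFin; [exact: nearW|exact: fcvg].
- apply: integrableD => //; first exact: integrable_f.
  exact: integrableS integrable_h.
- by apply/aeW => x n _; exact: dom.
apply: (@cvg_unique _ (@ereal_hausdorff R) _ _ _ _ _ If).
have -> : (fun n => \int[mu]_(x in A) (f_ n x)%:E) = (fun n => P_ n A).
  by apply/funext => n; rewrite Pf.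
have fin (Q : probability T R) : Q A \is a fin_num by exact: fin_num_measure.
rewrite -(fineK (fin P)); apply: cvg_EFin.
  by apply: nearW => n; exact: fin.
apply/cvgrPdist_le => e e0; near=> n.
have := PP n _ mA; rewrite -(fineK (fin (P_ n))) -(fineK (fin P)).
rewrite -EFinB lee_fin /= distrC => /le_trans; apply.
apply: (@le_trans _ _ (1 / 2 ^+ n)%R).
  by rewrite natrX !div1r lef_pV2 ?posrE ?exprn_gt0 // ler_weXn2l // ler1n.
apply: ltW; near: n; exact: near_infty_natSinv_expn_lt (PosNum e0).
Unshelve. all: by end_near. Qed.

End variation_convergence.

(** * Limits of exponential densities *)

(** Bolzano-Weierstrass without extracting subsequences: a cluster point of an ultrafilter is a
    limit. *)
Lemma ultra_bounded_cvg {I : Type} (R : realType) (d : nat) (G : set_system I)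
    (v : I -> 'rV[R]_d) (M : R) : UltraFilter G ->
  (\forall n \near G, `|v n| <= M) ->
  exists l : 'rV[R]_d, v n @[n --> G] --> l.
Proof.
move=> GU vM.
have Kcompact : compact [set x : 'rV[R]_d | `|x| <= M].
  apply: bounded_closed_compact.
    by exists M; split=> [|a Ma x /= xM]; [exact: num_real|
      exact: le_trans xM (ltW Ma)].
  have /continuous_closedP := @norm_continuous R 'rV[R]_d.
  by move=> /(_ [set x | x <= M] (@closed_le R M)).
have [l [_ lcl]] := Kcompact (v @ G) _ vM.
exists l => B lB; have [//|GB] := in_ultra_setVsetC (v @^-1` B) GU.
by have [x []] := lcl (~` B) B GB lB.
Qed.

Section closedness.
Context {R : realType} {d : nat}.
Variable mu : {measure set 'rV[R]_d -> \bar R}.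
Implicit Types (x y z u : 'rV[R]_d) (A B C D F : set 'rV[R]_d).

Variables (A_ : nat -> set 'rV[R]_d) (th_ : nat -> 'rV[R]_d) (c_ : nat -> R).
Let f_ n x : R := \1_(A_ n) x * expR (dotv (th_ n) x - c_ n).
Variables (N : set 'rV[R]_d) (f : 'rV[R]_d -> R).
Hypothesis mN : measurable N.
Hypothesis N0 : mu N = 0%E.
Hypothesis ff : forall x, ~ N x -> f_ n x @[n --> \oo] --> f x.

Variable G : set_system nat.
Hypothesis GU : UltraFilter G.
Hypothesis sG : \oo `<=` G.

Let f_ge0 n x : 0 <= f_ n x.
Proof. by rewrite mulr_ge0 ?expR_ge0. Qed.

Let f0 x : ~ N x -> 0 <= f x.
Proof.
move=> /ff fx; rewrite -(cvg_lim (@Rhausdorff R) fx).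
by apply: limr_ge; [apply/cvg_ex; exists (f x)|exact: nearW].
Qed.

Let fG x : ~ N x -> f_ n x @[n --> G] --> f x.
Proof. by move=> /ff fx B /fx; exact: sG. Qed.

Section direction.
Variables (A : set 'rV[R]_d) (eta : nat -> 'rV[R]_d).
Hypothesis AA : forall x, A x -> \forall n \near \oo, A_ n x.
Hypothesis Aeta : forall n x y, A x -> A y ->
  dotv (th_ n) x - dotv (th_ n) y = dotv (eta n) (x - y).

Let f_ratio x y : A x -> A y -> \forall n \near G,
  f_ n x = f_ n y * expR (dotv (eta n) (x - y)).
Proof.
move=> Ax Ay; near=> n; rewrite /f_ !indicE !mem_set; last 2 first.
- by near: n; exact/sG/AA.
- by near: n; exact/sG/AA.
rewrite !mul1r -expRD -Aeta //; congr expR; ring.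
Unshelve. all: by end_near. Qed.

(** The normalizing constants cancel in the ratio of [f_ n x] and [f_ n y], which therefore has a
    limit. *)
Lemma bounded_density l x y : A x -> A y -> ~ N x -> ~ N y ->
  eta n @[n --> G] --> l -> f x = f y * expR (dotv l (x - y)).
Proof.
move=> Ax Ay Nx Ny el; apply: (cvg_unique (@Rhausdorff R) (fG _ Nx)).
have : f_ n y * expR (dotv (eta n) (x - y)) @[n --> G] -->
    f y * expR (dotv l (x - y)).
  apply: cvgM; first exact: fG.
  apply: (cvg_comp _ _ (cvg_dotvl _ _ _ _ el)); exact: continuous_expR.
apply: cvg_trans; apply: near_eq_cvg.
by apply: filterS (f_ratio _ _ Ax Ay) => n ->.
Qed.

(** If [l] were larger at [y] than at [x], the ratio of [f_ n y] to [f_ n x] would blow up while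
    [f_ n x] stays above [f x / 2]. *)
Lemma unbounded_direction l x y : A x -> A y -> ~ N x -> ~ N y ->
  (forall M : R, \forall n \near G, M < `|eta n|) ->
  `|eta n|^-1 *: eta n @[n --> G] --> l -> f x != 0 ->
  dotv l y <= dotv l x.
Proof.
move=> Ax Ay Nx Ny eoo el fx; rewrite leNgt; apply/negP => lxy.
have fx0 : 0 < f x by rewrite lt_neqAle eq_sym fx f0.
have s0 : 0 < dotv l (y - x) by rewrite dotvBr subr_gt0.
set s := dotv l (y - x) in s0.
have sl := cvg_dotvl _ _ _ (y - x) el.
(* Chosen so that [f x / 2 * (M * (s / 2)) = f y + 1]; since [expR t] is at least [1 + t], this
   contradicts [f_ n y < f y + 1]. *)
pose M := ((f y + 1) * 4) / (f x * s).
have M0 : 0 <= M by rewrite /M divr_ge0 ?mulr_ge0 ?addr_ge0 ?f0 // ltW.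
suff : \forall n \near G, False by move=> /filter_ex[].
near=> n.
have n1 : f_ n y < f y + 1.
  by near: n; apply: (cvgr_lt (f y)); [exact: fG|rewrite ltrDl].
have n2 : f x / 2 < f_ n x.
  near: n; apply: (cvgr_gt (f x)); first exact: fG.
  by rewrite ltr_pdivrMr // ltr_pMr // ltr1n.
have n3 : s / 2 < dotv (`|eta n|^-1 *: eta n) (y - x).
  near: n; apply: (cvgr_gt s); first exact: sl.
  by rewrite ltr_pdivrMr // ltr_pMr // ltr1n.
have n4 : M < `|eta n| by near: n; exact: eoo.
have n40 : 0 < `|eta n| by near: n; exact: eoo.
have n5 : f_ n y = f_ n x * expR (dotv (eta n) (y - x)).
  by near: n; exact: f_ratio.
have n6 : M * (s / 2) <= dotv (eta n) (y - x).
  have -> : dotv (eta n) (y - x) =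
      `|eta n| * dotv (`|eta n|^-1 *: eta n) (y - x).
    by rewrite dotvZl mulrA mulfV ?mul1r // gt_eqF.
  by apply: ler_pM => //; [rewrite divr_ge0 // ltW|exact: ltW..].
have n7 : f_ n x * (1 + M * (s / 2)) <= f_ n y.
  rewrite n5 ler_pM2l; last by apply: lt_trans n2; rewrite divr_gt0.
  by apply: le_trans (expR_ge1Dx _); rewrite lerD2l.
have n8 : f x / 2 * (1 + M * (s / 2)) < f y + 1.
  apply: le_lt_trans n1; apply: le_trans n7; rewrite ler_pM2r ?(ltW n2) //.
  by rewrite ltr_pwDl // mulr_ge0 // divr_ge0 // ltW.
have ME : f x / 2 * (M * (s / 2)) = f y + 1.
  by rewrite /M; field; rewrite !gt_eqF.
have := n8; rewrite mulrDr mulr1 ME; have := divr_gt0 fx0 (ltr0n R 2).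
lra.
Unshelve. all: by end_near. Qed.

End direction.

(** Only the part [eta] of [th_] orthogonal to the rows of [U] matters for ratios on [A]. If it is
    bounded along [G], its limit is the parameter of [f]; otherwise its limiting direction is [u].
    The rows of [U] need not exhaust the functionals constant on [A], so [u] may be constant
    there. *)
Lemma flat_limit_step A (U : 'M[R]_d) x0 :
  (forall x, A x -> \forall n \near \oo, A_ n x) ->
  (forall x y g, A x -> A y -> (g <= U)%MS -> dotv g x = dotv g y) ->
  (forall x, ~ N x -> f x != 0 -> A x) -> ~ N x0 -> f x0 != 0 ->
  (exists th c, forall x, ~ N x -> f x = \1_A x * expR (dotv th x - c)) \/
  (exists2 u, ~~ (u <= U)%MS &
    forall x y, A x -> A y -> ~ N x -> ~ N y -> f x != 0 ->
      dotv u y <= dotv u x).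
Proof.
move=> AA AU fA Nx0 fx0; have Ax0 : A x0 by exact: fA.
have /choice[xi xiP] k : exists v, (v <= U)%MS /\ U *m (th_ k - v)^T = 0.
  exact: submx_orth_decomp.
pose eta k := th_ k - xi k.
have Aeta k x y : A x -> A y ->
    dotv (th_ k) x - dotv (th_ k) y = dotv (eta k) (x - y).
  move=> Ax Ay; have [xiU _] := xiP k.
  by rewrite dotvBl 2!dotvBr (AU x y (xi k)) // subrr subr0.
have [[M etaM]|unbounded] :=
    pselect (exists M : R, \forall k \near G, `|eta k| <= M); [left|right].
  have [l etal] := ultra_bounded_cvg _ _ _ _ _ GU etaM.
  have fx0_gt0 : 0 < f x0 by rewrite lt_neqAle eq_sym fx0 f0.
  exists l, (dotv l x0 - ln (f x0)) => x Nx.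
  rewrite indicE; have [/set_mem Ax|/negP nAx] := boolP (x \in A).
    rewrite mul1r (bounded_density A eta AA Aeta l x x0) //.
    by rewrite opprB addrCA -dotvBr expRD lnK.
  rewrite mul0r; apply: contra_notP nAx => /eqP fx; apply/mem_set.
  exact: fA.
have etaoo (M : R) : \forall k \near G, M < `|eta k|.
  have [GM|] := in_ultra_setVsetC [set k | `|eta k| <= M] GU.
    by case: unbounded; exists M.
  by apply: filterS => k /= /negP; rewrite -ltNge.
have n1 : \forall k \near G, `| `|eta k|^-1 *: eta k| = 1.
  apply: filterS (etaoo 0) => k ek.
  by rewrite normrZ normfV normr_id mulVf // gt_eqF.
have [u etau] : exists u, `|eta k|^-1 *: eta k @[k --> G] --> u.
  by apply: (ultra_bounded_cvg _ _ _ _ 1); apply: filterS n1 => k ->.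
exists u; last first.
  move=> x y Ax Ay Nx Ny fx; exact: (unbounded_direction A eta).
(* As a limit of vectors of norm 1 orthogonal to [U], [u] is nonzero and orthogonal to [U], so it is
   outside the row space. *)
have u1 : `|u| = 1.
  apply: (cvg_unique (@Rhausdorff R) (cvg_norm etau)).
  exact: cvg_near_cst.
have u0 : u != 0 by rewrite -normr_eq0 u1 oner_eq0.
apply: contra u0 => uU; rewrite -dotvv_eq0; apply/eqP.
apply: (cvg_unique (@Rhausdorff R) (cvg_dotvl _ _ _ u etau)).
apply: cvg_near_cst; apply: nearW => k; rewrite dotvZl.
by rewrite (dotv_submx_eq0 _ _ _ _ (xiP k).2) ?mulr0.
Qed.

(** In the unbounded case, cut the flat by the level of [u] through [x0]. Off [N], every point where
    [f] is nonzero has the maximal level, and points of higher level lie in [N]. The rank of [U]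
    grows even if the cut leaves the flat unchanged. *)
Lemma flat_limit_density A : flat mu A ->
  (forall x, A x -> \forall n \near \oo, A_ n x) ->
  (forall x, ~ N x -> f x != 0 -> A x) -> (exists2 x, ~ N x & f x != 0) ->
  exists B th c, flat mu B /\
    (forall x, ~ N x -> f x = \1_B x * expR (dotv th x - c)).
Proof.
move=> + + + [x0 Nx0 fx0].
suff: forall n B (U : 'M[R]_d), (d - \rank U <= n)%N -> flat mu B ->
    (forall x, B x -> \forall n \near \oo, A_ n x) ->
    (forall x y g, B x -> B y -> (g <= U)%MS -> dotv g x = dotv g y) ->
    (forall x, ~ N x -> f x != 0 -> B x) ->
    exists C th c, flat mu C /\
      (forall x, ~ N x -> f x = \1_C x * expR (dotv th x - c)).
  move=> + fA AA fA0 => /(_ d A 0); apply => //; first exact: leq_subr.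
  by move=> x y g _ _; rewrite submx0 => /eqP ->; rewrite !(dotvC 0) !dotv0r.
elim=> [|n IH] B U Un fB BA BU fB0;
    have [[th [c ?]]|[u uU uB]] := flat_limit_step _ _ _ BA BU fB0 Nx0 fx0;
    try by exists B, th, c.
  by rewrite full_rank_submx in uU.
have Bx0 : B x0 by exact: fB0.
apply: (IH (B `&` [set x | dotv u x = dotv u x0]) (U + u)%MS).
- exact: rank_adds_row.
- apply: flat_hyperplane => //; have [aB _] := fB.
  apply: (@subset_measure0 _ _ _ mu _ N) => //.
    apply: measurableI; first exact: affine_measurable.
    exact: measurable_open_halfspace.
  move=> x [Bx ux]; apply: contrapT => Nx; move: ux; apply/negP.
  by rewrite -leNgt; exact: uB.
- by move=> x [/BA].
- exact: constant_adds_row.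
- move=> x Nx fx; have Bx := fB0 x Nx fx; split => //=.
  by apply/eqP; rewrite eq_le !uB.
Qed.

End closedness.

Lemma flat_density_indic {R : realType} {d : nat}
    (mu : {measure set 'rV[R]_d -> \bar R}) A th (c : R) B : measurable A ->
  (\int[mu]_(x in B `&` A) (expR (dotv th x - c))%:E =
   \int[mu]_(x in B) (\1_A x * expR (dotv th x - c))%:E)%E.
Proof.
move=> mA; rewrite integral_mkcondr; apply: eq_integral => x _.
by rewrite patchE indicE; case: ifPn => _; rewrite ?mul1r ?mul0r.
Qed.

Theorem corollary3 (R : realType) (d : nat)
    (mu : {finite_measure set 'rV[R]_d -> \bar R})
    (mu_neq0 : mu setT <> 0%E) :
  variation_closed (extension mu).
Proof.
move=> P_ P extP dP.
have mufin : (mu setT < +oo)%E by rewrite ltey_eq fin_num_measure.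
(* Only the summable rate matters; the indices [phi k] need not increase. *)
have /choice[phi phiP] k : exists n,
    (variation_distance (P_ n) P < (1 / (2 ^ k.+1)%:R)%:E)%E.
  have k0 : (0 < (1 / (2 ^ k.+1)%:R)%:E :> \bar R)%E.
    by rewrite lte_fin divr_gt0 // ltr0n expn_gt0.
  have : \forall n \near \oo,
      (variation_distance (P_ n) P < (1 / (2 ^ k.+1)%:R)%:E)%E.
    exact: dP (open_ereal_lt' k0).
  exact: filter_ex.
have /choice[A_ A_P] k : exists A th c,
    flat_density mu (P_ (phi k)) A th c.
  exact: extension_flat_density.
have {A_P} /choice[th_ th_P] := A_P.
have {th_P} /choice[c_ densP] := th_P.
pose f_ k x : R := \1_(A_ k) x * expR (dotv (th_ k) x - c_ k).
have mA_ k : measurable (A_ k).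
  by have [[aA _] _] := densP k; exact: affine_measurable.
have mexp (th : 'rV[R]_d) c A : measurable A ->
    measurable_fun setT (fun x => \1_A x * expR (dotv th x - c)).
  move=> mA; apply: measurable_funM; first exact: measurable_indic.
  exact: measurable_expR_dotv.
have [|||| N [f [mN N0 mf ff Pf]]] :=
  @variation_limit_density _ _ _ mu f_ (P_ \o phi) P.
- by move=> k; exact: mexp.
- by move=> k x; rewrite mulr_ge0 ?expR_ge0.
- move=> k B mB; have [_ Pk] := densP k.
  by rewrite /= Pk // flat_density_indic.
- move=> k B mB; apply: le_trans (ltW (phiP k)).
  exact: le_variation_distance.
have [G [GU sG]] := ultraFilterLemma (@eventually_filter).
(* Otherwise [P] would have total mass 0. *)
have f0 : exists2 x, ~ N x & f x != 0.
  apply: contrapT => Nf.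
  have : P setT = 0%E.
    rewrite Pf // (ae_eq_integral (cst 0%E)) ?integral0 //.
      by apply/measurable_EFinP.
    exists N; split => // x; apply: contra_notP => Nx _ /=.
    by congr EFin; apply: contrapT => /eqP fx; apply: Nf; exists x.
  by rewrite probability_setT => /eqP; rewrite onee_eq0.
(* The initial flat is the set of points in all but finitely many [A_ k]. If [f x] is nonzero off
   [N], so is [f_ k x] eventually, and [x] is in that set. *)
have [|||B [th [c [fB fE]]]] := flat_limit_density mu A_ th_ c_ N f mN N0 ff
  G GU sG [set x | \forall n \near \oo, A_ n x] _ _ _ f0.
- by apply: flat_liminf => k; have [] := densP k.
- by [].
- move=> x Nx fx; have := cvgr_neq0 _ (ff x Nx) fx.
  move=> fk; near=> k; apply: contrapT => Akx.
  have /negP : f_ k x != 0 by near: k; exact: fk.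
  by apply; rewrite /f_ indicE memNset // mul0r.
have mB : measurable B by have [aB _] := fB; exact: affine_measurable.
apply: (@flat_density_extension _ _ _ mufin P B th c); split => // E mE.
rewrite Pf // flat_density_indic //; apply: ae_eq_integral => //.
- by apply/measurable_EFinP; exact: measurable_funTS.
- by apply/measurable_EFinP; apply: measurable_funTS; exact: mexp.
- exists N; split => // x; apply: contra_notP => Nx _.
  by rewrite fE.
Unshelve. all: by end_near. Qed.
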